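(* Let $a>c>0$, $b=\sqrt{a^2-c^2}$, and let $A_1=(c,0)$ be a fixed point of $\mathbb{R}^2$. Suppose that $P=P(\theta)$ is a moving point in $\mathbb{R}^2$ satisfying, for $0\le\theta\le2\pi$, the following conditions: 1) for $\mathcal{D}=|\overrightarrow{A_1P}|$, $$\frac{d^2\mathcal{D}}{d\theta^2}=\frac{-(ac\sin\theta-c^2\sin\theta\cos\theta)^2+[(a\cos\theta-c)^2+b^2\sin^2\theta]\,(ac\cos\theta-c^2\cos2\theta)}{[(a\cos\theta-c)^2+b^2\sin^2\theta]^{3/2}},$$ $$\frac{d\mathcal{D}}{d\theta}\Big|_{\theta=0}=0,\qquad \mathcal{D}|_{\theta=0}=a-c;$$ 2) $$\frac{d\vec e_{\overrightarrow{A_1P}}}{d\theta}=\frac{b(a-c\cos\theta)\,(-b\sin\theta,\,a\cos\theta-c)}{[(a\cos\theta-c)^2+b^2\sin^2\theta]^{3/2}},\qquad \vec e_{\overrightarrow{A_1P}}|_{\theta=0}=(1,0).$$ Then the trajectory of $P$ is the ellipse $\vec r(\theta)=(a\cos\theta,b\sin\theta)$, $0\le\theta\le2\pi$; that is, $P(\theta)=(a\cos\theta,b\sin\theta)$ for all $\theta\in[0,2\pi]$.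
   Context: $\vec e_{\vec w}=\vec w/|\vec w|$ denotes the unit vector in the direction of a nonzero vector $\vec w$; it is implicit that $\overrightarrow{A_1P}(\theta)\neq\vec0$. *)

(* Defs.v *)
From Stdlib Require Import Reals.
Open Scope R_scope.

Definition vec2 : Type := (R * R)%type.

Definition vsub (u v : vec2) : vec2 := (fst u - fst v, snd u - snd v).
Definition vscale (k : R) (u : vec2) : vec2 := (k * fst u, k * snd u).
Definition vnorm (u : vec2) : R := sqrt (fst u ^ 2 + snd u ^ 2).

(* Meaningful for [w <> (0, 0)] only. *)
Definition unit_vec (w : vec2) : vec2 := vscale (/ vnorm w) w.

(* Derivatives are taken relative to the interval (Stdlib's [D_in]), hence
   one-sided at its endpoints; values outside the interval are irrelevant. *)
Definition is_deriv_on (I : R -> Prop) (f f' : R -> R) : Prop :=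
  forall t, I t -> D_in f f' I t.

Definition is_vderiv_on (I : R -> Prop) (f f' : R -> vec2) : Prop :=
  is_deriv_on I (fun t => fst (f t)) (fun t => fst (f' t)) /\
  is_deriv_on I (fun t => snd (f t)) (fun t => snd (f' t)).

Definition period (t : R) : Prop := 0 <= t <= 2 * PI.

(* Main.v *)
(* Since b^2 = a^2 - c^2, the quantity (a cos t - c)^2 + b^2 (sin t)^2 equals
   (a - c cos t)^2. This collapses the given equation to D'' = c cos t, so D' = c sin t
   and D = a - c cos t, and turns the given derivative of the unit vector into that
   of (a cos t - c, b sin t) / (a - c cos t). Multiplying the unit vector by D
   gives the vector from A1 to P. *)

Require Import Defs.
From Stdlib Require Import Reals.
From Stdlib Require Import Lra.
From Coquelicot Require Import Coquelicot.
Open Scope R_scope.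

(* Precomposing [h] with the retraction onto the interval makes it differentiable
   in the two-sided sense at the endpoints too, so the mean value theorem applies. *)
Lemma D_in_zero_const (lo hi : R) (h : R -> R) :
  (forall x, lo <= x <= hi -> D_in h (fun _ => 0) (fun y => lo <= y <= hi) x) ->
  forall x, lo <= x <= hi -> h x = h lo.
Proof.
intros Hh x Hx.
pose (k := fun y => Rmax lo (Rmin hi y)).
assert (Hk : forall y, lo <= y <= hi -> k y = y).
{ intros y Hy; unfold k; rewrite Rmin_right, Rmax_right; lra. }
assert (Hkin : forall y, lo <= k y <= hi).
{ intros y; unfold k, Rmax, Rmin.
  destruct (Rle_dec hi y); destruct (Rle_dec lo _); lra. }
assert (Hklip : forall y z, Rabs (k y - k z) <= Rabs (y - z)).
{ intros y z; unfold k, Rmax, Rmin.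
  destruct (Rle_dec hi y); destruct (Rle_dec hi z);
    repeat destruct (Rle_dec lo _); unfold Rabs;
    repeat destruct (Rcase_abs _); lra. }
assert (Hder : forall y, lo <= y <= hi ->
  derivable_pt_lim (fun z => h (k z)) y 0).
{ intros y Hy eps Heps.
  destruct (Hh y Hy eps Heps) as [d [Hd Hlim]].
  exists (mkposreal d Hd); intros s Hs Hsd; simpl in Hsd.
  rewrite (Hk y Hy), Rminus_0_r.
  (* [D_in] says nothing at [y] itself. If [k] sends [y + s] back to [y], as happens beyond an
     endpoint, the quotient is 0. *)
  destruct (Req_dec (k (y + s)) y) as [E|E].
  { rewrite E, Rminus_diag; unfold Rdiv; rewrite Rmult_0_l, Rabs_R0; exact Heps. }
  assert (Hle : Rabs (k (y + s) - y) <= Rabs s).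
  { generalize (Hklip (y + s) y); rewrite (Hk y Hy).
    now replace (y + s - y) with s by ring. }
  assert (Hq : Rabs ((h (k (y + s)) - h y) / (k (y + s) - y)) < eps).
  { generalize (Hlim (k (y + s))); simpl; unfold Rdist; rewrite Rminus_0_r.
    intros H; apply H; split.
    - split; [apply Hkin | intros E'; apply E; now symmetry].
    - lra. }
  assert (Hs' : 0 < Rabs s) by now apply Rabs_pos_lt.
  (* Slope of [h] times slope of [k]: the latter is at most 1 in absolute value since [k] is
     1-Lipschitz, so the limit 0 survives. *)
  replace ((h (k (y + s)) - h y) / s)
    with ((h (k (y + s)) - h y) / (k (y + s) - y) * ((k (y + s) - y) / s))
    by (field; split; lra).
  rewrite Rabs_mult.
  apply Rle_lt_trans with (2 := Hq).
  rewrite <- Rmult_1_r; apply Rmult_le_compat_l; [apply Rabs_pos|].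
  rewrite Rabs_div by exact Hs.
  apply Rle_div_l; lra. }
destruct (Req_dec lo x) as [<-|Hne]; [reflexivity|].
destruct (MVT_cor2 (fun z => h (k z)) (fun _ => 0) lo x) as [z [Hz _]]; [lra| |].
{ intros z Hz; apply Hder; lra. }
rewrite (Hk x), (Hk lo) in Hz by lra; lra.
Qed.

(** The difference [f - g] has zero derivative relative to the interval and vanishes at 0. Each
    integration below is an instance, with an explicit candidate [g] smooth on the whole line. *)
Lemma is_deriv_on_unique (f f' g g' : R -> R) :
  is_deriv_on period f f' ->
  (forall t, is_derive g t (g' t)) ->
  (forall t, period t -> f' t = g' t) ->
  f 0 = g 0 ->
  forall t, period t -> f t = g t.
Proof.
intros Hf Hg Hfg H0 t Ht.
apply Rminus_diag_uniq.
rewrite (D_in_zero_const 0 (2 * PI) (fun s => f s - g s)); [lra| |exact Ht].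
intros s Hs.
apply (D_in_ext (fun u => f' u - g' u)); [rewrite (Hfg s Hs); ring|].
apply (Dminus period f' g' f g s); [exact (Hf s Hs)|].
apply (D_in_imp g g' no_cond); [easy|].
apply derivable_pt_lim_D_in, is_derive_Reals, Hg.
Qed.

Lemma Rpower_sqr_3_2 (x : R) : 0 < x -> Rpower (x ^ 2) (3 / 2) = x ^ 3.
Proof.
intros Hx.
rewrite <- (Rpower_pow 2 x Hx), Rpower_mult, <- (Rpower_pow 3 x Hx).
f_equal; simpl; field.
Qed.

(** This is the distance from the focus (c, 0) to the ellipse point; its positivity justifies every
    division and the use of [Rpower]. *)
Lemma focal_distance_pos (a c t : R) : 0 < c -> c < a -> 0 < a - c * cos t.
Proof.
intros hc hac; destruct (COS_bound t) as [_ H].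
assert (c * cos t <= c * 1) by (apply Rmult_le_compat_l; lra); lra.
Qed.

Lemma focal_distance_sqr (a b c t : R) : b ^ 2 = a ^ 2 - c ^ 2 ->
  (a * cos t - c) ^ 2 + b ^ 2 * sin t ^ 2 = (a - c * cos t) ^ 2.
Proof.
intros Hb; rewrite Hb.
replace (sin t ^ 2) with (1 - cos t ^ 2)
  by (rewrite <- !Rsqr_pow2, sin2; reflexivity).
ring.
Qed.

Theorem theorem5p5
  (a b c : R) (hc : 0 < c) (hac : c < a) (hb : b = sqrt (a ^ 2 - c ^ 2))
  (A1 : vec2) (hA1 : A1 = (c, 0))
  (P : R -> vec2)
  (hP : forall t, period t -> vsub (P t) A1 <> (0, 0))
  (D D' : R -> R)
  (hD : forall t, period t -> D t = vnorm (vsub (P t) A1))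
  (hD' : is_deriv_on period D D')
  (hD'' : is_deriv_on period D' (fun t =>
     (- (a * c * sin t - c ^ 2 * sin t * cos t) ^ 2
      + ((a * cos t - c) ^ 2 + b ^ 2 * sin t ^ 2)
        * (a * c * cos t - c ^ 2 * cos (2 * t)))
     / Rpower ((a * cos t - c) ^ 2 + b ^ 2 * sin t ^ 2) (3 / 2)))
  (hD'0 : D' 0 = 0)
  (hD0 : D 0 = a - c)
  (he' : is_vderiv_on period (fun t => unit_vec (vsub (P t) A1)) (fun t =>
     vscale
       (b * (a - c * cos t)
        / Rpower ((a * cos t - c) ^ 2 + b ^ 2 * sin t ^ 2) (3 / 2))
       (- b * sin t, a * cos t - c)))
  (he0 : unit_vec (vsub (P 0) A1) = (1, 0)) :
  forall t, period t -> P t = (a * cos t, b * sin t).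
Proof.
assert (hb2 : b ^ 2 = a ^ 2 - c ^ 2) by (rewrite hb; apply pow2_sqrt; nra).
assert (hq : forall t, 0 < a - c * cos t) by (intros; now apply focal_distance_pos).
assert (hR : forall t, Rpower ((a * cos t - c) ^ 2 + b ^ 2 * sin t ^ 2) (3 / 2)
                       = (a - c * cos t) ^ 3).
{ intros t; rewrite focal_distance_sqr by exact hb2; now apply Rpower_sqr_3_2. }
assert (hs : forall t, sin t ^ 2 = 1 - cos t ^ 2).
{ intros t; rewrite <- !Rsqr_pow2; apply sin2. }
assert (HD' : forall t, period t -> D' t = c * sin t).
{ apply (is_deriv_on_unique _ _ _ (fun t => c * cos t) hD'').
  - intros t; auto_derive; [easy|ring].
  (* With q = a - c cos t, q^2 factors out of the numerator, and sin^2 = 1 - cos^2 leaves c cos t *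
     q^3. *)
  - intros t _; rewrite hR, focal_distance_sqr, cos_2a_cos by exact hb2.
    replace (a * c * sin t - c ^ 2 * sin t * cos t)
      with (c * sin t * (a - c * cos t)) by ring.
    rewrite !Rpow_mult_distr, hs; field.
    apply Rgt_not_eq, hq.
  - rewrite sin_0; lra. }
assert (HD : forall t, period t -> D t = a - c * cos t).
{ apply (is_deriv_on_unique _ _ _ (fun t => c * sin t) hD').
  - intros t; auto_derive; [easy|ring].
  - exact HD'.
  - rewrite cos_0; lra. }
destruct he' as [hx hy].
assert (Hx : forall t, period t ->
  fst (unit_vec (vsub (P t) A1)) = (a * cos t - c) / (a - c * cos t)).
{ apply (is_deriv_on_unique _ _ _
    (fun t => - b ^ 2 * sin t / (a - c * cos t) ^ 2) hx).
  - intros t; specialize (hq t); auto_derive; [lra|].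
    (* The quotient rule gives the numerator (c^2 - a^2) sin t, which is -b^2 sin t. *)
    rewrite hb2; field; lra.
  - intros t _; specialize (hq t); cbn [fst snd vscale]; rewrite hR; field; lra.
  - rewrite he0, cos_0; simpl; field; lra. }
assert (Hy : forall t, period t ->
  snd (unit_vec (vsub (P t) A1)) = b * sin t / (a - c * cos t)).
{ apply (is_deriv_on_unique _ _ _
    (* Raw quotient-rule form; the inner factor equals a cos t - c once sin^2 is eliminated. *)
    (fun t => b * (cos t * (a - c * cos t) - c * sin t ^ 2) / (a - c * cos t) ^ 2) hy).
  - intros t; specialize (hq t); auto_derive; [lra|].
    field; lra.
  - intros t _; specialize (hq t); cbn [fst snd vscale]; rewrite hR, hs; field; lra.
  - rewrite he0, sin_0, cos_0; simpl; field; lra. }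
intros t Ht.
specialize (Hx t Ht); specialize (Hy t Ht); specialize (hq t).
(* The norm inside the unit vector is [D t], now known, so clearing denominators yields the
   coordinates of P. *)
unfold unit_vec in Hx, Hy; rewrite <- (hD t Ht), (HD t Ht), hA1 in Hx, Hy.
destruct (P t) as [x y]; simpl in Hx, Hy.
apply (f_equal (Rmult (a - c * cos t))) in Hx, Hy.
field_simplify in Hx; [|lra|lra].
field_simplify in Hy; [|lra|lra].
f_equal; lra.
Qed.
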